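(* Let $B_s$ denote the Bernoulli numbers ($B_0=1$, $B_s=-\frac{1}{s+1}\sum_{k=0}^{s-1}\binom{s+1}{k}B_k$ for $s\ge1$). Define $B^*_0=1$, $B^*_1=\frac14$ and, for $s\ge2$, $B^*_s=-\frac{1}{s+1}\sum_{k=0}^{s-1}\binom{s+1}{k}2^{k-s}B_k$. For integers $s\ge0$ let \[R_{2s+1}(z)=\sum_{k=0}^{s+1}\frac{B_{2k}B_{2s+2-2k}}{(2k)!(2s+2-2k)!}z^{2k},\] and for integers $r\ge0$ let \[Q_r(z)=\sum_{k=0}^{\lfloor (r+1)/2\rfloor}\frac{B^*_{r+1-2k}B^*_{2k}}{(r+1-2k)!(2k)!}z^{2k}.\] Then for every integer $s\ge0$: $Q_{2s+1}(z)=R_{2s+1}(z)$, and \[Q_{2s}(z)=4z^{2s+2}\left(R_{2s+1}\left(\tfrac1z\right)-R_{2s+1}\left(\tfrac1{2z}\right)\right)=4\left(R_{2s+1}(z)-\frac{1}{2^{2s+2}}R_{2s+1}(2z)\right).\] Moreover, writing $R_{2s}(z):=Q_{2s}(z)$, the two-term reciprocal relation \[R_{2s}(z)-R_{2s}\left(\tfrac z2\right)=z^{2s+2}\left(R_{2s}\left(\tfrac1z\right)-R_{2s}\left(\tfrac1{2z}\right)\right)\] holds.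
   Context: $\lfloor\cdot\rfloor$ denotes the integer part. The polynomials $R_{2s+1}$ are the (odd-indexed) Ramanujan polynomials; they satisfy $R_{2s+1}(z)=z^{2s+2}R_{2s+1}(1/z)$. *)

(* Defs.v *)
From mathcomp Require Import all_boot all_order all_algebra.

Set Implicit Arguments.
Unset Strict Implicit.
Unset Printing Implicit Defensive.

Import Order.TTheory GRing.Theory Num.Theory.
Local Open Scope ring_scope.

(* [:: B_0; ...; B_(n-1)]: a list makes the course-of-values recursion
   structural; bernoulli0 and bernoulliE below are the defining recurrence. *)
Fixpoint bernoulli_seq (n : nat) : seq rat :=
  if n is m.+1 then
    let b := bernoulli_seq m in
    rcons b (if m == 0%N then 1
             else - (m.+1%:R)^-1 * \sum_(0 <= k < m) 'C(m.+1, k)%:R * b`_k)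
  else [::].

Definition bernoulli (s : nat) : rat := (bernoulli_seq s.+1)`_s.

Lemma size_bernoulli_seq n : size (bernoulli_seq n) = n.
Proof. by elim: n => //= n IHn; rewrite size_rcons IHn. Qed.

Lemma nth_bernoulli_seq n k : (k < n)%N -> (bernoulli_seq n)`_k = bernoulli k.
Proof.
elim: n => // n IHn; rewrite ltnS leq_eqVlt => /predU1P[-> // | ltkn].
by rewrite /= nth_rcons size_bernoulli_seq ltkn IHn.
Qed.

Lemma bernoulli0 : bernoulli 0 = 1.
Proof. by []. Qed.

Lemma bernoulliE (s : nat) : (1 <= s)%N ->
  bernoulli s =
  - (s.+1%:R)^-1 * \sum_(0 <= k < s) 'C(s.+1, k)%:R * bernoulli k.
Proof.
move=> s_gt0; rewrite {1}/bernoulli /= nth_rcons size_bernoulli_seq ltnn eqxx.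
rewrite eqn0Ngt s_gt0 /=; congr (_ * _).
by apply: eq_big_nat => k /andP[_ ltks]; rewrite nth_bernoulli_seq.
Qed.

Definition bernoulli_star (s : nat) : rat :=
  match s with
  | 0 => 1
  | 1 => 4^-1
  | _ => - (s.+1%:R)^-1 *
         \sum_(0 <= k < s) 'C(s.+1, k)%:R * 2 ^ (k%:Z - s%:Z) * bernoulli k
  end.

(* ramanujan_odd s is R_(2s+1), indexed by s. *)
Definition ramanujan_odd (s : nat) : {poly rat} :=
  \sum_(0 <= k < s.+2)
    (bernoulli (2 * k) * bernoulli (2 * s + 2 - 2 * k)
      / ((2 * k)`!%:R * (2 * s + 2 - 2 * k)`!%:R)) *: 'X^(2 * k).

(* Q r is Q_r; (r + 1)./2 is the integer part of (r + 1)/2. *)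
Definition Q (r : nat) : {poly rat} :=
  \sum_(0 <= k < ((r + 1)./2).+1)
    (bernoulli_star (r + 1 - 2 * k) * bernoulli_star (2 * k)
      / ((r + 1 - 2 * k)`!%:R * (2 * k)`!%:R)) *: 'X^(2 * k).

(* ramanujan_even s is R_(2s), indexed by s. *)
Definition ramanujan_even (s : nat) : {poly rat} := Q (2 * s).

(* Value of a rational polynomial at a point of an arbitrary number field
   structure: rat, a realType, the complex numbers R[i], algC, ... *)
Definition peval (F : numFieldType) (p : {poly rat}) (z : F) : F :=
  (map_poly ratr p).[z].

(* Main.v *)
(** Both families of numbers are read off the Bernoulli polynomials [B_n(x)],
    which are the only Appell sequence starting at [1] whose increments
    [B_n(1) - B_n(0)] are [delta_(n,1)]. Since [(-1)^n B_n(1-x)] and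
    [2^(n-1) (B_n(x/2) + B_n((x+1)/2))] are such sequences too, the Bernoulli
    numbers of odd index at least 3 vanish and [B_n(1/2) = (2^(1-n) - 1) B_n].
    Hence [B*_(2k) = B_(2k)] and
    [B*_(2k+1) = (4 - 4^(-k)) B_(2k+2) / (2k+2)], which makes [Q_(2s+1)] equal
    to [R_(2s+1)] and gives [Q_(2s)] in terms of [R_(2s+1)] coefficientwise.
    The other relations follow from the palindromy of [R_(2s+1)]. *)

Require Import Defs.
From mathcomp Require Import all_boot all_order all_algebra.
From mathcomp Require Import ring lra.

Set Implicit Arguments.
Unset Strict Implicit.
Unset Printing Implicit Defensive.

Import Order.TTheory GRing.Theory Num.Theory.
Local Open Scope ring_scope.

(** * Uniqueness of Appell sequences with prescribed increments over [0, 1] *)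

Lemma deriv_eq0 (F : numFieldType) (p : {poly F}) :
  p^`() = 0 -> p = (p`_0)%:P.
Proof.
move=> p'0; apply/polyP => -[|i]; rewrite coefC //=.
have /eqP := congr1 (fun q : {poly F} => q`_i) p'0.
by rewrite coef_deriv coef0 mulrn_eq0 /= => /eqP.
Qed.

(** If [d n] is 0, then [d n.+1] is a constant c, and [d n.+2] is (n + 2) c X plus a constant. Its
    equal values at 0 and 1 force c = 0. *)
Lemma appell_eq0 (F : numFieldType) (d : nat -> {poly F}) :
    d 0 = 0 ->
    (forall n, (d n.+1)^`() = n.+1%:R *: d n) ->
    (forall n, (d n).[1] = (d n).[0]) ->
  forall n, d n = 0.
Proof.
move=> d0 d' d01; elim=> // n IHn.
have dS : d n.+1 = ((d n.+1)`_0)%:P by apply: deriv_eq0; rewrite d' IHn scaler0.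
set c := (d n.+1)`_0 in dS.
have /deriv_eq0 dSS : (d n.+2 - (n.+2%:R * c) *: 'X)^`() = 0.
  by rewrite derivB derivZ derivX d' dS -mul_polyC -rmorphM alg_polyC subrr.
have := d01 n.+2; rewrite -[d n.+2](subrK ((n.+2%:R * c) *: 'X)) dSS.
rewrite !hornerE => /eqP.
rewrite -subr_eq0 addrC addKr mulf_eq0 pnatr_eq0 /= => /eqP c0.
by rewrite dS c0.
Qed.

Lemma appell_uniq (F : numFieldType) (p q : nat -> {poly F}) :
    p 0 = q 0 ->
    (forall n, (p n.+1)^`() = n.+1%:R *: p n) ->
    (forall n, (q n.+1)^`() = n.+1%:R *: q n) ->
    (forall n, (p n).[1] - (p n).[0] = (q n).[1] - (q n).[0]) ->
  forall n, p n = q n.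
Proof.
move=> pq0 p' q' pq01 n; apply/eqP; rewrite -subr_eq0; apply/eqP.
apply: (@appell_eq0 _ (fun m => p m - q m)) => [|m|m].
- by rewrite pq0 subrr.
- by rewrite derivB p' q' scalerBr.
- apply/eqP; rewrite !hornerE -subr_eq0; apply/eqP.
  by rewrite -[RHS](subrr ((q m).[1] - (q m).[0])) -{1}pq01; ring.
Qed.

(** * Bernoulli polynomials and their functional equations *)

Definition bernoulli_poly (n : nat) : {poly rat} :=
  \sum_(k < n.+1) ('C(n, k)%:R * bernoulli k) *: 'X^(n - k).

Lemma bernoulli_poly0 : bernoulli_poly 0 = 1.
Proof. by rewrite /bernoulli_poly big_ord1 bernoulli0 mulr1 scale1r. Qed.

Lemma horner_bernoulli_poly n x :
  (bernoulli_poly n).[x] =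
  \sum_(k < n.+1) 'C(n, k)%:R * bernoulli k * x ^+ (n - k).
Proof.
by rewrite horner_sum; apply: eq_bigr => k _; rewrite hornerZ hornerXn.
Qed.

Lemma bernoulli_poly_at0 n : (bernoulli_poly n).[0] = bernoulli n.
Proof.
rewrite horner_bernoulli_poly big_ord_recr /= subnn binn mulr1 mul1r.
by rewrite big1 ?add0r // => k _; rewrite expr0n subn_eq0 leqNgt ltn_ord mulr0.
Qed.

Lemma deriv_bernoulli_poly n :
  (bernoulli_poly n.+1)^`() = n.+1%:R *: bernoulli_poly n.
Proof.
rewrite /bernoulli_poly big_ord_recr /= subnn expr0 derivD derivZ derivC.
rewrite scaler0 addr0 raddf_sum scaler_sumr; apply: eq_bigr => k _ /=.
have le_kn : (k <= n)%N by rewrite -ltnS.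
rewrite derivZ derivXn subSn //= -scaler_nat !scalerA; congr (_ *: _).
rewrite mulrAC mulrA -!natrM; congr (_%:R * _).
by rewrite (mul_bin_down n.+1) subSn // mulnC.
Qed.

Lemma bernoulli_poly_increment n :
  (bernoulli_poly n).[1] - (bernoulli_poly n).[0] = (n == 1)%:R.
Proof.
rewrite bernoulli_poly_at0 horner_bernoulli_poly big_ord_recr /=.
rewrite subnn binn mulr1 mul1r addrK.
case: n => [|[|n]]; first by rewrite big_ord0.
  by rewrite big_ord1 bin0 bernoulli0 expr1n !mulr1.
(* The recurrence for the last Bernoulli number in the sum, cleared of its denominator, says that
   the whole sum vanishes. *)
rewrite big_ord_recr /= binSn expr1n mulr1 bernoulliE //.
rewrite mulNr mulrN mulVKf ?pnatr_eq0 // big_mkord; apply/eqP; rewrite subr_eq0.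
by apply/eqP/eq_bigr => k _; rewrite expr1n mulr1.
Qed.

Lemma bernoulli_poly_reflection n :
  bernoulli_poly n = (-1) ^+ n *: (bernoulli_poly n \Po (1 - 'X)).
Proof.
move: n; apply: appell_uniq => [|n|n|n].
- by rewrite bernoulli_poly0 scale1r comp_polyC.
- exact: deriv_bernoulli_poly.
- rewrite derivZ deriv_comp deriv_bernoulli_poly derivB derivX derivC.
  rewrite sub0r mulrN1 comp_polyZ scalerN -scaleNr !scalerA exprS mulN1r opprK.
  by rewrite mulrC.
(* Swapping the endpoints negates the increment, which is nonzero only for n = 1, where the sign
   (-1)^n restores it. *)
- rewrite bernoulli_poly_increment !hornerZ !horner_comp !hornerE subrr.
  rewrite -mulrBr -opprB bernoulli_poly_increment.
  by case: n => [|[|n]] /=; rewrite ?oppr0 ?mulr0.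
Qed.

Lemma bernoulli_poly_duplication n :
  bernoulli_poly n =
  (2 ^+ n / 2) *: ((bernoulli_poly n \Po (2^-1 *: 'X)) +
                   (bernoulli_poly n \Po (2^-1 *: ('X + 1)))).
Proof.
move: n; apply: appell_uniq => [|n|n|n].
- by rewrite bernoulli_poly0 !comp_polyC -polyCD -mul_polyC -polyCM.
- exact: deriv_bernoulli_poly.
- rewrite derivZ derivD !deriv_comp deriv_bernoulli_poly !comp_polyZ !derivZ.
  rewrite derivD derivX derivC addr0 -mulrDl -scalerDr -scalerAr mulr1 !scalerA.
  by congr (_ *: _); rewrite exprS; field.
- rewrite bernoulli_poly_increment !hornerZ !hornerD !horner_comp !hornerE.
  rewrite (_ : 2^-1 * (1 + 1) = 1); last by [].
  (* The two values at 1/2 cancel, leaving the increment from 0 to 1; the factor 2^n / 2 is 1 when n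
     = 1. *)
  rewrite -mulrBr [_ + _.[1]]addrC [_.[0] + _]addrC addrKA.
  rewrite bernoulli_poly_increment.
  by case: n => [|[|n]] //=; rewrite mulr0.
Qed.

(** Reflection at 0 gives B_n(0) = -B_n(1), whereas the zero increment gives B_n(0) = B_n(1). *)
Lemma bernoulli_odd n : odd n -> (1 < n)%N -> bernoulli n = 0.
Proof.
move=> n_odd n_gt1.
have := bernoulli_poly_increment n.
rewrite (negbTE (_ : n != 1)) ?gtn_eqF // => /eqP; rewrite subr_eq0 => /eqP.
have := congr1 (fun p : {poly rat} => p.[0]) (bernoulli_poly_reflection n).
rewrite hornerZ horner_comp !hornerE bernoulli_poly_at0.
rewrite -signr_odd n_odd /=; lra.
Qed.

Lemma bernoulli_poly_half n :
  (bernoulli_poly n).[2^-1] = (2 / 2 ^+ n - 1) * bernoulli n.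
Proof.
have := congr1 (fun p : {poly rat} => p.[0]) (bernoulli_poly_duplication n).
rewrite hornerZ hornerD !horner_comp !hornerE !bernoulli_poly_at0.
have n2 : 2 ^+ n != 0 :> rat by rewrite expf_neq0.
move=> half_eq; rewrite mulrBl mul1r {1}half_eq; field.
exact: n2.
Qed.

(** * Closed forms for the numbers B* *)

(** The sum defining B*_s is twice the part k < s of the expansion of B_(s+1)(1/2). The terms k = s
    and k = s + 1 left out of it produce the two summands here. *)
Lemma bernoulli_starE s : (1 < s)%N ->
  bernoulli_star s =
  bernoulli s + (4 - 2 / 2 ^+ s) / s.+1%:R * bernoulli s.+1.
Proof.
case: s => [|[|s]] // _; rewrite /bernoulli_star.
set n := s.+2; have := bernoulli_poly_half n.+1.
rewrite horner_bernoulli_poly 2!big_ord_recr /= subnn subSnn binn binSn.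
set S := \sum_(k < n) _.
have -> : \sum_(0 <= k < n) 'C(n.+1, k)%:R * 2 ^ (k%:Z - n%:Z) * bernoulli k
          = 2 * S.
  rewrite big_mkord mulr_sumr; apply: eq_bigr => k _.
  have le_kn : (k <= n)%N by apply: ltnW.
  rewrite -opprB subzn // -exprnN subSn // exprS exprVn; field.
  by rewrite expf_neq0.
have n2 : 2 ^+ n != 0 :> rat by rewrite expf_neq0.
have nS : n.+1%:R != 0 :> rat by rewrite pnatr_eq0.
rewrite expr1 expr0 mul1r mulr1 exprS => half_eq.
have {half_eq}-> : S = (2 / (2 * 2 ^+ n) - 1) * bernoulli n.+1
                - bernoulli n.+1 - n.+1%:R * bernoulli n * 2^-1.
  by rewrite -half_eq; ring.
by field; rewrite n2 nS.
Qed.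

Lemma bernoulli_star_even k : bernoulli_star (2 * k) = bernoulli (2 * k).
Proof.
case: k => [//|k]; have gt1 : (1 < 2 * k.+1)%N by rewrite mulnS.
rewrite bernoulli_starE // (@bernoulli_odd _.+1) ?mulr0 ?addr0 //.
by rewrite oddS oddM.
Qed.

Lemma bernoulli_star_odd k :
  bernoulli_star (2 * k).+1 =
  (4 - (4 ^+ k)^-1) / (2 * k).+2%:R * bernoulli (2 * k).+2.
Proof.
case: k => [|k].
  (* Index 1 is outside [bernoulli_starE]: the prescribed B*_1 = 1/4 equals (4 - 1)/2 times B_2 =
     1/6, whereas the recurrence would give -1/4. *)
  rewrite muln0 bernoulliE // big_nat_recr // big_nat1.
  by rewrite (@bernoulliE 1) // big_nat1 bernoulli0.
have gt1 : (1 < (2 * k.+1).+1)%N by rewrite mulnS.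
have odd_index : odd (2 * k.+1).+1 by rewrite oddS oddM.
rewrite bernoulli_starE // (bernoulli_odd odd_index) // add0r exprS exprM -natrX.
congr ((_ - _) / _ * _).
have n4 : 4 ^+ k.+1 != 0 :> rat by rewrite expf_neq0.
by field.
Qed.

(** * Coefficientwise comparison of Q with the odd Ramanujan polynomials *)

Lemma double_index s k : (2 * s + 2 - 2 * k = 2 * (s.+1 - k))%N.
Proof. by rewrite addnC -mulnS mulnBr. Qed.

Lemma Q_odd s : Q (2 * s + 1) = ramanujan_odd s.
Proof.
have two_sS : (2 * s + 1 + 1 = 2 * s + 2)%N by rewrite -addnA.
rewrite /Q /ramanujan_odd two_sS.
have -> : (2 * s + 2)./2 = s.+1 by rewrite addnC -mulnS mul2n doubleK.
apply: eq_big_nat => k _.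
rewrite double_index !bernoulli_star_even; congr (_ *: _).
by rewrite [X in X / _]mulrC [X in _ / X]mulrC.
Qed.

Lemma Q_even s :
  Q (2 * s) =
  4 *: (ramanujan_odd s -
        (2 ^+ (2 * s + 2))^-1 *: (ramanujan_odd s \Po (2 *: 'X))).
Proof.
rewrite /Q /ramanujan_odd.
have -> : (2 * s + 1)./2 = s by rewrite mul2n addnC (half_bit_double s true).
rewrite raddf_sum scaler_sumr -sumrB scaler_sumr [RHS]big_nat_recr //=.
have dilate c m : (2 ^+ (2 * s + 2))^-1 *: ((c *: 'X^m) \Po (2 *: 'X)) =
    (c * 2 ^+ m / 2 ^+ (2 * s + 2)) *: 'X^m :> {poly rat}.
  by rewrite comp_polyZ comp_Xn_poly exprZn !scalerA; congr (_ *: _); ring.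
(* The right-hand side has one more term, of degree 2s + 2; it cancels because the dilation
   multiplies it by exactly 2^(2s+2). *)
rewrite [X in _ + X](_ : _ = 0) ?addr0; last first.
  have -> : (2 * s.+1 = 2 * s + 2)%N by rewrite mulnS addnC.
  by rewrite dilate mulfK ?expf_neq0 // subrr scaler0.
apply: eq_big_nat => k; rewrite ltnS /= => le_ks.
rewrite dilate -scalerBl scalerA; congr (_ *: _).
rewrite double_index subSn // mulnS.
have -> : (2 * s + 1 - 2 * k = (2 * (s - k)).+1)%N.
  by rewrite addn1 mulnBr subSn // leq_mul2l.
(* With j = s - k, the factor 4 - 4^(-j) of B*_(2j+1) is 4 (1 - 2^(2k) / 2^(2s+2)), and its
   denominator 2j + 2 turns (2j+1)! into (2j+2)!. *)
rewrite bernoulli_star_odd bernoulli_star_even.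
have -> : 2 ^+ (2 * s + 2) = 4 ^+ (s - k) * 4 * 2 ^+ (2 * k) :> rat.
  rewrite [in LHS](_ : 2 * s + 2 = 2 * (s - k).+1 + 2 * k)%N; last first.
    by rewrite -mulnDr addSn subnK // mulnS addnC.
  by rewrite exprD [2 ^+ (2 * _.+1)]exprM -natrX exprSr.
rewrite [(_.+2)`!]factS natrM.
have n4 m : 4 ^+ m != 0 :> rat by rewrite expf_neq0.
have n2 m : 2 ^+ m != 0 :> rat by rewrite expf_neq0.
have nf m : m`!%:R != 0 :> rat by rewrite pnatr_eq0 -lt0n fact_gt0.
have nS : 2 + 2 * (s - k)%:R != 0 :> rat by rewrite -natrM -natrD pnatr_eq0.
by field; rewrite n2 n4 !nf nS.
Qed.

(** * Evaluation at points of a field, and reciprocity *)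

Lemma peval_ramanujan_odd (F : numFieldType) s (z : F) :
  peval (ramanujan_odd s) z = \sum_(0 <= k < s.+2)
    ratr (bernoulli (2 * k) * bernoulli (2 * s + 2 - 2 * k)
      / ((2 * k)`!%:R * (2 * s + 2 - 2 * k)`!%:R)) * z ^+ (2 * k).
Proof.
rewrite /peval /ramanujan_odd rmorph_sum horner_sum; apply: eq_bigr => k _ /=.
by rewrite map_polyZ map_polyXn hornerZ hornerXn.
Qed.

(** The coefficients are invariant under k -> s + 1 - k, so reversing the sum suffices. *)
Lemma ramanujan_odd_reciprocal (F : numFieldType) s (z : F) : z != 0 ->
  z ^+ (2 * s + 2) * peval (ramanujan_odd s) z^-1 = peval (ramanujan_odd s) z.
Proof.
move=> z0; rewrite !peval_ramanujan_odd big_nat_rev mulr_sumr.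
apply: eq_big_nat => k /andP[_]; rewrite ltnS => le_k /=.
rewrite add0n subSS !double_index subKn // exprVn mulrCA.
rewrite [bernoulli _ * _]mulrC [_`!%:R * _]mulrC; congr (_ * _).
have -> : (2 * s + 2 = 2 * k + 2 * (s.+1 - k))%N.
  by rewrite -mulnDr subnKC // mulnS addnC.
by rewrite exprD mulfK // expf_neq0.
Qed.

Lemma peval_Q_even (F : numFieldType) s (z : F) :
  peval (Q (2 * s)) z =
  4 * (peval (ramanujan_odd s) z -
       (2 ^+ (2 * s + 2))^-1 * peval (ramanujan_odd s) (2 * z)).
Proof.
rewrite Q_even /peval map_polyZ rmorphB /= map_polyZ map_comp_poly map_polyZ.
rewrite /= map_polyX !hornerE /= horner_comp !hornerE.
by rewrite fmorphV rmorphXn /= !ratr_nat.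
Qed.

Theorem theorem1p1 (s : nat) :
  [/\ Q (2 * s + 1) = ramanujan_odd s,
      forall (F : numFieldType) (z : F), z != 0 ->
        peval (Q (2 * s)) z =
        4 * z ^+ (2 * s + 2) *
          (peval (ramanujan_odd s) z^-1 - peval (ramanujan_odd s) (2 * z)^-1),
      forall (F : numFieldType) (z : F),
        peval (Q (2 * s)) z =
        4 * (peval (ramanujan_odd s) z -
             (2 ^+ (2 * s + 2))^-1 * peval (ramanujan_odd s) (2 * z))
    & forall (F : numFieldType) (z : F), z != 0 ->
        peval (ramanujan_even s) z - peval (ramanujan_even s) (z / 2) =
        z ^+ (2 * s + 2) *
          (peval (ramanujan_even s) z^-1 -
           peval (ramanujan_even s) (2 * z)^-1)].
Proof.
have two_neq0 (F : numFieldType) : (2 : F) != 0 by rewrite pnatr_eq0.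
have pow2_neq0 (F : numFieldType) n : (2 : F) ^+ n != 0.
  by rewrite expf_neq0 ?two_neq0.
split.
- exact: Q_odd.
- move=> F z z0; rewrite peval_Q_even.
  have z2 : 2 * z != 0 by rewrite mulf_neq0 ?two_neq0.
  (* Reciprocity at 2z yields the factor (2z)^(2s+2), whose power of 2 cancels the one in the
     denominator. *)
  rewrite -(ramanujan_odd_reciprocal s z0) -(ramanujan_odd_reciprocal s z2).
  by rewrite exprMn; field; exact: pow2_neq0.
- by move=> F z; apply: peval_Q_even.
- move=> F z z0; rewrite /ramanujan_even !peval_Q_even.
  have z2 : 2 * z != 0 by rewrite mulf_neq0 ?two_neq0.
  have zh : z / 2 != 0 by rewrite mulf_neq0 ?invr_eq0 ?two_neq0.
  have -> : 2 * (z / 2) = z by field.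
  have -> : 2 * (2 * z)^-1 = z^-1 by field.
  have -> : 2 * z^-1 = (z / 2)^-1 by field.
  (* Reciprocity at z, 2z and z/2 writes both sides through the values at 1/z, 1/(2z) and 2/z, with
     equal coefficients. *)
  rewrite -(ramanujan_odd_reciprocal s z0) -(ramanujan_odd_reciprocal s z2).
  rewrite -(ramanujan_odd_reciprocal s zh) exprMn expr_div_n.
  by field; exact: pow2_neq0.
Qed.
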